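(* Let $\alpha\in[0,1]$. For every vector $w=(0,y,z)\in\mathbb{R}^3$, $$\|w\|_\alpha^2=y^2+z^2-2(1-\alpha)yz\ \ge\ \alpha(y^2+z^2),$$ and hence $$\|w\|_\alpha\ \ge\ \sqrt{\alpha}\,\sqrt{y^2+z^2}=\sqrt{\alpha}\,\|w\|_2 .$$
   Context: For $\alpha\in[0,1]$ and $w=(w_1,w_2,w_3)\in\mathbb{R}^3$, $\|w\|_\alpha=\sqrt{w_1^2+w_2^2+w_3^2-2(1-\alpha)w_2w_3}$; $\|\cdot\|_2$ is the Euclidean norm on $\mathbb{R}^3$. *)

(* Defs.v *)
From HB Require Import structures.
From mathcomp Require Import all_boot all_order all_algebra.
From mathcomp Require Import reals.

Set Implicit Arguments.
Unset Strict Implicit.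
Unset Printing Implicit Defensive.

Import Order.TTheory GRing.Theory Num.Theory.
Local Open Scope ring_scope.

(* R^3 is 'rV[R]_3. Indices start at 0 and are numerals of the ring 'I_3:
   w 0 0, w 0 1, w 0 2 are w_1, w_2, w_3. *)
Definition row3 (R : realType) (x y z : R) : 'rV[R]_3 :=
  \row_(i < 3) [:: x; y; z]`_i.

(* Num.sqrt is 0 on negative arguments, but for 0 <= alpha <= 1 the quantity
   under the root is nonnegative. *)
Definition alpha_norm (R : realType) (alpha : R) (w : 'rV[R]_3) : R :=
  Num.sqrt (w 0 0 ^+ 2 + w 0 1 ^+ 2 + w 0 2 ^+ 2
            - 2 * (1 - alpha) * w 0 1 * w 0 2).

(* The library's norm `|w| on row vectors is the maximum norm, hence this
   separate definition. *)
Definition euclidean_norm (R : realType) (n : nat) (w : 'rV[R]_n) : R :=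
  Num.sqrt (\sum_(i < n) w 0 i ^+ 2).

(* Main.v *)
Require Import Defs.
From HB Require Import structures.
From mathcomp Require Import all_boot all_order all_algebra.
From mathcomp Require Import reals.
From mathcomp Require Import ring.
Import Order.TTheory GRing.Theory Num.Theory.
Local Open Scope ring_scope.

(** Writing q for the quadratic form under the root of the alpha-norm, the
    difference q - alpha (y^2 + z^2) on the plane w_1 = 0 is the square
    (y - z)^2 with weight 1 - alpha >= 0 ([plane_form_gap]).  So q dominates
    alpha (y^2 + z^2); since alpha >= 0, this lower bound is nonnegative, hence
    q is too and the alpha-norm squares back to q.  The bound on norms follows
    because the square root is monotone and multiplicative. *)

Lemma plane_form_gap (R : comNzRingType) (alpha y z : R) :
  y ^+ 2 + z ^+ 2 - 2 * (1 - alpha) * y * z - alpha * (y ^+ 2 + z ^+ 2)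
    = (1 - alpha) * (y - z) ^+ 2.
Proof. by ring. Qed.

Lemma plane_form_ge (R : realDomainType) (alpha y z : R) :
  alpha <= 1 ->
  alpha * (y ^+ 2 + z ^+ 2) <= y ^+ 2 + z ^+ 2 - 2 * (1 - alpha) * y * z.
Proof.
move=> alpha_le1.
by rewrite -subr_ge0 plane_form_gap mulr_ge0 ?sqr_ge0 // subr_ge0.
Qed.

Lemma alpha_norm_plane (R : realType) (alpha y z : R) :
  alpha_norm alpha (row3 0 y z)
    = Num.sqrt (y ^+ 2 + z ^+ 2 - 2 * (1 - alpha) * y * z).
Proof. by rewrite /alpha_norm !mxE /= expr0n add0r. Qed.

Lemma euclidean_norm_plane (R : realType) (y z : R) :
  euclidean_norm (row3 0 y z) = Num.sqrt (y ^+ 2 + z ^+ 2).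
Proof.
rewrite /euclidean_norm !big_ord_recl big_ord0 !mxE /=.
by rewrite expr0n add0r addr0.
Qed.

Theorem mainTheorem3 (R : realType) (alpha : R)
    (halpha0 : 0 <= alpha) (halpha1 : alpha <= 1) (y z : R) :
  let w := row3 0 y z in
  [/\ alpha_norm alpha w ^+ 2 = y ^+ 2 + z ^+ 2 - 2 * (1 - alpha) * y * z,
      y ^+ 2 + z ^+ 2 - 2 * (1 - alpha) * y * z >= alpha * (y ^+ 2 + z ^+ 2),
      alpha_norm alpha w >= Num.sqrt alpha * Num.sqrt (y ^+ 2 + z ^+ 2)
    & Num.sqrt alpha * Num.sqrt (y ^+ 2 + z ^+ 2)
        = Num.sqrt alpha * euclidean_norm w].
Proof.
move=> w; rewrite /w alpha_norm_plane euclidean_norm_plane.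
have form_ge := plane_form_ge _ _ y z halpha1.
have low_ge0 : 0 <= alpha * (y ^+ 2 + z ^+ 2).
  by rewrite mulr_ge0 // addr_ge0 // sqr_ge0.
have form_ge0 := le_trans low_ge0 form_ge.
split=> //; first by rewrite sqr_sqrtr.
by rewrite -sqrtrM // ler_wsqrtr.
Qed.
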